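(* Let $a,b$ be positive integers. A bi-colored graph $G=(V,E=B\sqcup R)$ is $[a,b]$-sparse if and only if it can be constructed with the $[a,b]$-pebble game, i.e., if and only if there is a finite sequence of allowed moves of the $[a,b]$-pebble game on $V$, starting from the initial configuration, ending in a configuration whose underlying undirected bi-colored graph is $G$.
   Context: A bi-colored graph is a finite multigraph $G=(V,E=B\sqcup R)$ whose edges are partitioned into black edges $B$ and red edges $R$. A multigraph is $(k,\ell)$-sparse if every nonempty subset of $n'$ vertices spans at most $kn'-\ell$ edges, and $(k,\ell)$-tight if in addition it has exactly $kn-\ell$ edges, $n$ being its number of vertices. A $(k,\ell)$-block is a set of vertices inducing a $(k,\ell)$-tight graph; a $(k,\ell)$-component is a vertex-maximal $(k,\ell)$-block. $G$ is $[a,b]$-sparse if there is $B'\subseteq B$ such that $(V,R\cup B')$ is $(a,a)$-sparse and $(V,B\setminus B')$ is $(b,b)$-sparse. The $[a,b]$-pebble game on $V$. A configuration consists of a directed bi-colored graph on $V$, with every edge covered by exactly one pebble, which is colored aqua or tan, together with some free aqua and tan pebbles on the vertices. Initial configuration: no edges; every vertex has $a$ free aqua and $b$ free tan pebbles. Allowed moves (preconditions in brackets; counts of pebbles ''on $i$ and $j$'' are totals over the two vertices): - Add red edge $ij$ [at least $a+1$ free aqua pebbles on $i$ and $j$]: add the new red edge, cover it with a free aqua pebble taken from $i$, orient it out of $i$. - Add black edge $ij$ [at least $a+1$ free aqua pebbles on $i$ and $j$, or at least $b+1$ free tan pebbles on $i$ and $j$]: add the new black edge, cover it with a free pebble taken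 from $i$, using aqua (if there are $a+1$ aqua) or tan (if there are $b+1$ tan), and orient it out of $i$. - Edge reversal [vertex $j$ has a free pebble and an in-edge $ij$ covered by a pebble of the same color]: reorient the edge out of $j$, cover it with the pebble from $j$, and return the pebble that covered it to $i$. - Aqua exchange edge reversal [vertex $j$ has a free aqua pebble and a black in-edge $ij$ covered by a tan pebble; $i$ and $j$ do not belong to the same $(a,a)$-component of the graph of aqua-covered edges]: reorient the edge out of $j$, cover it with the aqua pebble from $j$, and return the tan pebble that covered it to $i$. - Tan exchange edge reversal [vertex $j$ has a free tan pebble and a black in-edge $ij$ covered by an aqua pebble; $i$ and $j$ do not belong to the same $(b,b)$-component of the graph of tan-covered edges]: reorient the edge out of $j$, cover it with the tan pebble from $j$, and return the aqua pebble that covered it to $i$. *)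

(* Defs.v *)
From HB Require Import structures.
From mathcomp Require Import all_boot.

Set Implicit Arguments.
Unset Strict Implicit.
Unset Printing Implicit Defensive.

(* A multigraph on [V] with edge names in [E] is given by an incidence map
   [inc : E -> {set V}] (a loop has a singleton as its set of endpoints) and by
   the set [F] of edge names that are present. *)
Section Sparsity.
Variables (V E : finType) (inc : E -> {set V}) (k l : nat).
Implicit Types (F : {set E}) (X Y : {set V}).

Definition spanned F X : {set E} := [set e in F | inc e \subset X].

(* Sparsity of the subgraph induced by [X]. The bounds [m <= k n' - l] and
   [m = k n - l] are written without subtraction, which truncates on [nat]. *)
Definition sparse_on F X : bool :=
  [forall Y : {set V}, (Y \subset X) && (Y != set0) ==>
     (#|spanned F Y| + l <= k * #|Y|)].

Definition sparse F : bool := sparse_on F setT.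

Definition tight_on F X : bool :=
  sparse_on F X && (#|spanned F X| + l == k * #|X|).

Definition block F X : bool := tight_on F X.

Definition component F X : bool := maxset (block F) X.

Definition same_component F (i j : V) : Prop :=
  exists X : {set V}, [/\ component F X, i \in X & j \in X].

End Sparsity.

Record bigraph (V E : finType) := BiGraph {
  ends : E -> {set V};
  is_red : E -> bool;
  endsP : forall e, 0 < #|ends e| <= 2
}.

Section BiGraphSparsity.
Variables (V E : finType) (G : bigraph V E).

Definition red_edges : {set E} := [set e | is_red G e].
Definition black_edges : {set E} := [set e | ~~ is_red G e].

Definition ab_sparse (a b : nat) : Prop :=
  exists B' : {set E},
    [/\ B' \subset black_edges,
        sparse (ends G) a a (red_edges :|: B') &
        sparse (ends G) b b (black_edges :\: B')].

End BiGraphSparsity.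

Variant pebble := Aqua | Tan.

Definition pebble_to_bool (p : pebble) : bool := if p is Aqua then true else false.
Definition bool_to_pebble (c : bool) : pebble := if c then Aqua else Tan.
Lemma pebble_to_boolK : cancel pebble_to_bool bool_to_pebble.
Proof. by case. Qed.
HB.instance Definition _ := Equality.copy pebble (can_type pebble_to_boolK).

(* An edge directed from [src] to [tgt]; [cover] is the pebble covering it. *)
Record dedge (V : finType) := DEdge {
  src : V;
  tgt : V;
  dred : bool;
  cover : pebble
}.

(* [arc c e = None] when no edge named [e] has been added yet. *)
Record config (V E : finType) := Config {
  arc : E -> option (dedge V);
  free : pebble -> V -> nat
}.

Section PebbleGame.
Variables (V E : finType) (a b : nat).
Implicit Types (c : config V E) (e : E) (i j v : V) (p q : pebble).

Definition cap p : nat := if p is Aqua then a else b.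

Definition initial : config V E :=
  Config (fun _ => None) (fun p _ => cap p).

Definition dends (d : dedge V) : {set V} := [set src d; tgt d].

Definition cinc c e : {set V} := if arc c e is Some d then dends d else set0.

Definition covered c p : {set E} :=
  [set e | if arc c e is Some d then cover d == p else false].

(* Summing over the set [[set i; j]] counts the pebbles of [i] once if [i = j],
   so that, as in any sparse graph, loops are never created. *)
Definition free_on c p i j : nat := \sum_(v in [set i; j]) free c p v.

Definition set_arc c e (d : dedge V) : E -> option (dedge V) :=
  fun e' => if e' == e then Some d else arc c e'.

Definition take_pebble (f : pebble -> V -> nat) p v : pebble -> V -> nat :=
  fun q w => f q w - ((q == p) && (w == v)).

Definition put_pebble (f : pebble -> V -> nat) p v : pebble -> V -> nat :=
  fun q w => f q w + ((q == p) && (w == v)).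

Definition add_edge c e i j (r : bool) p : config V E :=
  Config (set_arc c e (DEdge i j r p)) (take_pebble (free c) p i).

(* The edge [e], of colour [r], directed from [i] to [j] and covered by [q],
   becomes directed from [j] to [i] and covered by the pebble [p] of [j]. *)
Definition reverse_edge c e i j (r : bool) q p : config V E :=
  Config (set_arc c e (DEdge j i r p))
         (put_pebble (take_pebble (free c) p j) q i).

(* [Exchange] with [p = Aqua] is the aqua exchange edge reversal, and with
   [p = Tan] the tan one. *)
Inductive move c : config V E -> Prop :=
| AddRed e i j of
    arc c e = None & a.+1 <= free_on c Aqua i j & 0 < free c Aqua i :
    move c (add_edge c e i j true Aqua)
| AddBlack e i j p of
    arc c e = None & (cap p).+1 <= free_on c p i j & 0 < free c p i :
    move c (add_edge c e i j false p)
| Reversal e i j r p of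
    arc c e = Some (DEdge i j r p) & 0 < free c p j :
    move c (reverse_edge c e i j r p p)
| Exchange e i j q p of
    arc c e = Some (DEdge i j false q) & q <> p & 0 < free c p j &
    ~ same_component (cinc c) (cap p) (cap p) (covered c p) i j :
    move c (reverse_edge c e i j false q p).

Inductive reachable : config V E -> Prop :=
| ReachInit : reachable initial
| ReachMove c c' of reachable c & move c c' : reachable c'.

Definition underlying c (G : bigraph V E) : Prop :=
  forall e, exists d : dedge V,
    [/\ arc c e = Some d, dends d = ends G e & dred d = is_red G e].

Definition constructible (G : bigraph V E) : Prop :=
  exists2 c, reachable c & underlying c G.

End PebbleGame.

(* Main.v *)
(** Soundness: on every vertex the free pebbles and the out-edges of a colour
    add up to its capacity. Hence the colour-[p] edges spanned by [X] number at
    most [cap p * #|X|] minus the free pebbles on [X], and an added edge needs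
    [cap p + 1] of these on its endpoints; an exchange can only break the
    sparsity of a tight set containing both endpoints, which would lie in a
    component.

    Completeness: a partition witnessing [a,b]-sparsity tells in advance which
    pebble should cover each edge, so edges are added in any order, without any
    exchange. If at most [cap p] pebbles are free on [i] and [j], some vertex
    reachable from them has a free pebble, since otherwise the set of reachable
    vertices would be too dense to span the new edge as well; reversing a path
    brings this pebble to [i] or [j]. *)
From mathcomp Require Import all_boot zify.
Require Import Defs.

Set Implicit Arguments.
Unset Strict Implicit.
Unset Printing Implicit Defensive.

Lemma sum_nat_delta (T : finType) (S : {set T}) (u : T) :
  \sum_(v in S) (u == v : nat) = (u \in S).
Proof.
case: (boolP (u \in S)) => uS.
  rewrite (bigD1 u) //= eqxx big1 ?addn0 // => v /andP[_ vu].
  by rewrite eq_sym (negPf vu).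
by rewrite big1 // => v vS; case: eqP uS => // ->; rewrite vS.
Qed.

Lemma sparseP (V E : finType) (inc : E -> {set V}) (k l : nat) (F : {set E}) :
  reflect (forall X : {set V}, X != set0 -> #|spanned inc F X| + l <= k * #|X|)
          (sparse inc k l F).
Proof.
apply: (iffP forallP) => [H X X0 | H X].
  by move: (H X); rewrite subsetT X0.
by apply/implyP => /andP[_]; apply: H.
Qed.

Section Game.
Variables (V E : finType) (a b : nat).
Implicit Types (c : config V E) (e : E) (d : dedge V) (p q : pebble)
  (i j u v w : V) (X S : {set V}).

Notation cap := (cap a b).
Notation reachable := (reachable a b).
Notation pspan c p X := (spanned (cinc c) (covered c p) X).

(** * Edge counts and the pebble balance *)

Definition out_edges c p X : {set E} :=
  [set e | if arc c e is Some d then (cover d == p) && (src d \in X) else false].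

Lemma card_out_edges c p X :
  \sum_(v in X) #|out_edges c p [set v]| = #|out_edges c p X|.
Proof.
have cardE Y : #|out_edges c p Y| =
    \sum_e (if arc c e is Some d then (cover d == p) && (src d \in Y) else false).
  rewrite -sum1_card big_mkcond; apply: eq_bigr => e _; rewrite inE.
  by case: (arc c e) => // d; case: (_ && _).
rewrite cardE (eq_bigr _ (fun v _ => cardE [set v])) exchange_big /=.
apply: eq_bigr => e _; case: (arc c e) => [d|]; last by rewrite big1.
case: (cover d == p) => /=; last by rewrite big1.
by rewrite -sum_nat_delta; apply: eq_bigr => v _; rewrite inE.
Qed.

(** Only [e] can change its contribution. The old one is added on the left rather than subtracted on
    the right, so that additions and reversals are treated alike. *)
Lemma card_out_edges_set_arc c c' e d p X : arc c' = set_arc c e d ->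
  #|out_edges c' p X|
    + (if arc c e is Some d0 then (cover d0 == p) && (src d0 \in X) else false)
  = #|out_edges c p X| + ((cover d == p) && (src d \in X)).
Proof.
move=> c'E; rewrite (cardsD1 e) [#|out_edges c p X|](cardsD1 e) !inE c'E /set_arc eqxx.
suff -> : out_edges c' p X :\ e = out_edges c p X :\ e
  by case: (arc c e) => [d0|]; lia.
by apply/setP => x; rewrite !inE c'E /set_arc; case: eqP.
Qed.

Lemma card_spanned_set_arc c c' e d p X : arc c' = set_arc c e d ->
  #|pspan c' p X|
    + (if arc c e is Some d0 then (cover d0 == p) && (dends d0 \subset X)
       else false)
  = #|pspan c p X| + ((cover d == p) && (dends d \subset X)).
Proof.
move=> c'E; rewrite (cardsD1 e) [#|pspan c p X|](cardsD1 e) !inE /cinc c'E /set_arc eqxx.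
set A := _ :\ e; set B := _ :\ e; suff -> : A = B by case: (arc c e) => [d0|]; lia.
by apply/setP => x; rewrite !inE /cinc c'E /set_arc; case: eqP.
Qed.

Lemma spanned_sub_out_edges c p X : pspan c p X \subset out_edges c p X.
Proof.
apply/subsetP => e; rewrite !inE /cinc; case: (arc c e) => // d.
by case/andP => -> /subsetP-> //; rewrite !inE eqxx.
Qed.

Definition balanced c :=
  forall p v, free c p v + #|out_edges c p [set v]| = cap p.

Lemma balanced_sum c p X : balanced c ->
  \sum_(v in X) free c p v + #|out_edges c p X| = cap p * #|X|.
Proof.
move=> bal; rewrite -card_out_edges -big_split /=.
by rewrite (eq_bigr _ (fun v _ => bal p v)) sum_nat_const mulnC.
Qed.

Lemma add_edge_balanced c e i j r p :
  balanced c -> arc c e = None -> 0 < free c p i -> balanced (add_edge c e i j r p).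
Proof.
move=> bal ce fi q v; have := bal q v.
have := card_out_edges_set_arc (c' := add_edge c e i j r p) q [set v] erefl.
rewrite ce /= inE /take_pebble (eq_sym v) (eq_sym q).
by case: eqP => [<-|_]; case: eqP => [<-|_] /=; lia.
Qed.

(** Letting [q] and [p] differ covers ordinary reversals and exchanges at once. The free pebble on
    [j] makes the truncated subtraction in [take_pebble] exact. *)
Lemma reverse_edge_balanced c e i j r q p :
  balanced c -> arc c e = Some (DEdge i j r q) -> 0 < free c p j ->
  balanced (reverse_edge c e i j r q p).
Proof.
move=> bal ce fj p' v; have := bal p' v.
have := card_out_edges_set_arc (c' := reverse_edge c e i j r q p) p' [set v] erefl.
rewrite ce /= !inE /take_pebble /put_pebble !(eq_sym v) !(eq_sym p').
by case: (eqVneq p p') => [<-|_]; case: (eqVneq j v) => [<-|_] /=; lia.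
Qed.

Lemma reachable_balanced c : reachable c -> balanced c.
Proof.
elim=> [|{}c c' _ bal mv].
  move=> p v; rewrite (_ : out_edges _ _ _ = set0) ?cards0 ?addn0 //.
case: mv => *; by [apply: add_edge_balanced | apply: reverse_edge_balanced].
Qed.

(** * Invariance of the sparsity of both colour classes *)

Definition pebble_sparse c := forall p, sparse (cinc c) (cap p) (cap p) (covered c p).

Lemma add_edge_sparse c e i j r p :
  balanced c -> pebble_sparse c -> arc c e = None ->
  (cap p).+1 <= free_on c p i j -> pebble_sparse (add_edge c e i j r p).
Proof.
move=> bal sp ce fij p'; apply/sparseP => X X0.
have := card_spanned_set_arc (c' := add_edge c e i j r p) p' X erefl.
rewrite ce addn0 => -> /=.
have := sparseP _ _ _ _ (sp p') X X0.
case: eqP => [<-{p'}|_] /=; last by lia.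
case: (boolP (_ \subset _)) => [sX _|_]; last by lia.
have := subset_leq_card (spanned_sub_out_edges c p X).
have := balanced_sum p X bal.
(* The free pebbles on the endpoints lie in [X], and the balance on [X] turns them into room for the
   new edge. *)
suff : free_on c p i j <= \sum_(v in X) free c p v by lia.
rewrite /free_on (big_setID [set i; j] (A := X)) /=.
by rewrite (setIidPr sX) leq_addr.
Qed.

(** Spanned edge counts ignore directions, and the covering colour is kept. *)
Lemma reversal_sparse c e i j r p :
  pebble_sparse c -> arc c e = Some (DEdge i j r p) ->
  pebble_sparse (reverse_edge c e i j r p p).
Proof.
move=> sp ce p'; apply/sparseP => X X0.
have := card_spanned_set_arc (c' := reverse_edge c e i j r p p) p' X erefl.
rewrite ce /= /dends /= setUC => /addIn ->.
exact: (sparseP _ _ _ _ (sp p')).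
Qed.

Lemma exchange_sparse c e i j r q p :
  pebble_sparse c -> arc c e = Some (DEdge i j r q) ->
  ~ same_component (cinc c) (cap p) (cap p) (covered c p) i j ->
  pebble_sparse (reverse_edge c e i j r q p).
Proof.
move=> sp ce ncomp p'; apply/sparseP => X X0.
have := card_spanned_set_arc (c' := reverse_edge c e i j r q p) p' X erefl.
have := sparseP _ _ _ _ (sp p') X X0.
rewrite ce /= /dends /= (setUC [set j]); case: (eqVneq p p') => [<-{p'}|_] /=; last by lia.
case: (boolP (_ \subset X)) => [sX|_]; last by lia.
(* A strict inequality leaves room for the edge gained by colour [p]; equality makes [X] a block,
   hence part of a component containing [i] and [j]. *)
rewrite leq_eqVlt => /orP[tight|]; last by lia.
have blockX : block (cinc c) (cap p) (cap p) (covered c p) X.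
  rewrite /block /tight_on tight andbT; apply/forallP => Y.
  by apply/implyP => /andP[_]; apply: (sparseP _ _ _ _ (sp p)).
have [Z maxZ /subsetP sXZ] := maxset_exists blockX.
case: ncomp; exists Z; split=> //; apply: sXZ; apply: (subsetP sX);
  by rewrite !inE eqxx ?orbT.
Qed.

Lemma reachable_sparse c : reachable c -> pebble_sparse c.
Proof.
elim=> [|{}c c' rc sp mv].
  move=> p; apply/sparseP => X X0; rewrite (_ : spanned _ _ _ = set0).
    by rewrite cards0 add0n leq_pmulr // card_gt0.
  by apply/setP => e; rewrite !inE.
case: mv => [e i j|e i j p|e i j r p|e i j q p] ce.
- by move=> *; apply: add_edge_sparse => //; apply: reachable_balanced.
- by move=> *; apply: add_edge_sparse => //; apply: reachable_balanced.
- by move=> *; apply: reversal_sparse.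
by move=> *; apply: exchange_sparse.
Qed.

(** Only exchanges change the colour covering an edge, and they act on black edges. *)
Lemma reachable_red c : reachable c ->
  forall e d, arc c e = Some d -> dred d -> cover d = Aqua.
Proof.
elim=> [//|{}c c' _ IH mv] e0 d.
case: mv => [e i j _ _ _|e i j p _ _ _|e i j r p ce _|e i j q p _ _ _ _];
  rewrite /= /set_arc; case: eqP => [_ [<-] //=|_]; try exact: IH.
by apply: (IH _ _ ce).
Qed.

(** * Moving free pebbles along directed paths *)

Definition uarc c e : option ({set V} * bool * pebble) :=
  omap (fun d => (dends d, dred d, cover d)) (arc c e).

(** [uarc] forgets only the orientation, which spanned sets do not see. *)
Lemma spanned_uarc c c' p X : uarc c' =1 uarc c -> pspan c' p X = pspan c p X.
Proof.
move=> sh; apply/setP => e; have := sh e; rewrite !inE /uarc /cinc.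
by case: (arc c e) => [d|]; case: (arc c' e) => [d'|] //= [-> _ ->].
Qed.

Definition step c p : rel V := fun u v =>
  [exists e, if arc c e is Some d then [&& src d == u, tgt d == v & cover d == p]
             else false].

(** The pebble travels from [w] back to [u]. Steps out of vertices other than [u] survive, which
    allows reversals to be chained along a path. *)
Lemma reverse_step c p u w : reachable c -> step c p u w -> 0 < free c p w ->
  exists c', [/\ reachable c', uarc c' =1 uarc c,
    forall x y, x != u -> step c p x y -> step c' p x y,
    0 < free c' p u &
    forall S, w \notin S ->
      \sum_(v in S) free c' p v = \sum_(v in S) free c p v + (u \in S)].
Proof.
move=> rc /existsP[e]; case ce: (arc c e) => [[i j r q]|] //=.
move=> /and3P[/eqP? /eqP? /eqP?] fw; subst i j q.
exists (reverse_edge c e u w r p p); split.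
- by apply: ReachMove rc _; apply: Reversal.
- move=> x; rewrite /uarc /= /set_arc; case: eqP => // ->.
  by rewrite ce /= /dends /= setUC.
- move=> x y xu /existsP[e']; rewrite /step.
  case ce': (arc c e') => [d|] // He'; apply/existsP; exists e'.
  rewrite /= /set_arc; case: eqP => [ee|_]; last by rewrite ce'.
  by move: ce' He' xu; rewrite ee ce => -[<-] /= /and3P[/eqP-> _ _]; rewrite eqxx.
- by rewrite /= /put_pebble !eqxx addn1.
move=> S wS; rewrite -sum_nat_delta -big_split /=; apply: eq_bigr => v vS.
rewrite /put_pebble /take_pebble eqxx /= (eq_sym v u).
by case: (eqVneq v w) wS => [<-|]; rewrite ?vS // subn0.
Qed.

(** The path is reversed from its far end until the pebble enters [S]. As the path is simple, its
    remaining arcs do not leave [u], so they survive each reversal; as [w] is outside [S], nothing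
    is lost there. *)
Lemma reverse_path c p x s w S : reachable c -> x \in S -> w \notin S ->
  path (step c p) x (rcons s w) -> uniq (x :: rcons s w) -> 0 < free c p w ->
  exists c', [/\ reachable c', uarc c' =1 uarc c &
    \sum_(v in S) free c p v < \sum_(v in S) free c' p v].
Proof.
elim/last_ind: s c w => [|s u IH] c w rc xS wS.
  move=> /= /andP[st _] _ fw; have [c' [rc' sh _ _ sm]] := reverse_step rc st fw.
  by exists c'; split; rewrite // sm // xS addn1.
rewrite rcons_path last_rcons => /andP[pth st] un fw.
have [c' [rc' sh keep fu sm]] := reverse_step rc st fw.
case: (boolP (u \in S)) => uS.
  by exists c'; split; rewrite // sm // uS addn1.
have unu : uniq (x :: rcons s u) by move: un; rewrite -!rcons_cons rcons_uniq => /andP[].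
have [|c'' [rc'' sh' lt]] := IH c' u rc' xS uS _ unu fu.
  move: pth; rewrite !rcons_path => /andP[ps st'].
  have unxs : u \notin x :: s by move: unu; rewrite -rcons_cons rcons_uniq => /andP[].
  apply/andP; split; last first.
    by apply: keep st'; apply: contraNneq unxs => <-; apply: mem_last.
  have avoid : all [pred z | z != u] (x :: s).
    by apply/allP => z zs; apply: contraNneq unxs => <-.
  by apply: sub_in_path avoid ps => y z yu _; apply: keep.
exists c''; split=> //; first by move=> z; rewrite sh' sh.
by rewrite sm // (negPf uS) addn0 in lt.
Qed.

(** The bound on spanned edges says that colour [p] has room for one more edge joining [i] and
    [j]. *)
Lemma collect_one c p i j : reachable c -> i != j ->
  (forall X, i \in X -> j \in X -> #|pspan c p X| + cap p < cap p * #|X|) ->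
  free_on c p i j <= cap p ->
  exists c', [/\ reachable c', uarc c' =1 uarc c &
    free_on c p i j < free_on c' p i j].
Proof.
move=> rc ij sp few.
pose X := [set v | connect (step c p) i v || connect (step c p) j v].
have iX : i \in X by rewrite inE connect0.
have jX : j \in X by rewrite inE connect0 orbT.
have closedX : out_edges c p X \subset pspan c p X.
  apply/subsetP => e; rewrite !inE /cinc; case ce: (arc c e) => [d|] //.
  move=> /andP[/eqP cd sX]; rewrite cd eqxx; apply/subsetP => v.
  have st : connect (step c p) (src d) (tgt d).
    by apply: connect1; apply/existsP; exists e; rewrite ce cd !eqxx.
  rewrite in_set2 => /orP[/eqP-> //|/eqP->].
  by move: sX; rewrite !inE => /orP[] H; rewrite (connect_trans H st) ?orbT.
(* No edge of colour [p] leaves [X], so by balance more than [cap p] pebbles are free on [X], and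
   [i] and [j] hold at most [cap p] of them. *)
have [w [wX wS fw]] : exists w, [/\ w \in X, w \notin [set i; j] & 0 < free c p w].
  have := balanced_sum p X (reachable_balanced rc).
  have := sp X iX jX; have := subset_leq_card closedX.
  rewrite (big_setID [set i; j]) /= (setIidPr _); last first.
    by apply/subsetP => v; rewrite !inE => /orP[]/eqP->; rewrite connect0 ?orbT.
  rewrite -/(free_on c p i j) => H1 H2 H3.
  have : 0 < \sum_(v in X :\: [set i; j]) free c p v by lia.
  rewrite lt0n sum_nat_eq0 negb_forall => /existsP[w].
  by rewrite negb_imply inE -lt0n => /andP[/andP[? ?] ?]; exists w.
have [x xS /connectP[s0 /shortenP[s ps us _] ew]] :
    exists2 x, x \in [set i; j] & connect (step c p) x w.
  by move: wX; rewrite inE => /orP[?|?]; [exists i|exists j]; rewrite // !inE eqxx ?orbT.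
case/lastP: s ps us ew => [|s w'] ps us ew.
  by move: wS; rewrite ew /= xS.
by rewrite last_rcons in ew; rewrite -ew in ps us; apply: reverse_path ps us fw.
Qed.

Lemma collect c p i j : reachable c -> i != j ->
  (forall X, i \in X -> j \in X -> #|pspan c p X| + cap p < cap p * #|X|) ->
  exists c', [/\ reachable c', uarc c' =1 uarc c & cap p < free_on c' p i j].
Proof.
move=> + ij; have [n] := ubnP (cap p - free_on c p i j).
elim: n c => // n IH c bound rc sp.
case: (ltnP (cap p) (free_on c p i j)) => [?|few]; first by exists c.
have [c1 [rc1 sh1 lt1]] := collect_one rc ij sp few.
(* The truncated deficit strictly decreases only if the new count is still at most [cap p]. *)
case: (ltnP (cap p) (free_on c1 p i j)) => [?|few1]; first by exists c1.
have [||X iX jX|c2 [rc2 sh2 lt2]] := IH c1; rewrite ?(spanned_uarc _ _ sh1) //.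
- by lia.
- exact: sp.
by exists c2; split=> // e; rewrite sh2 sh1.
Qed.

(** * Adding edges, and the two implications *)

Lemma add_reachable c e i j (r : bool) p : reachable c -> arc c e = None -> i != j ->
  (r -> p = Aqua) -> cap p < free_on c p i j ->
  reachable (add_edge c e i j r p).
Proof.
move=> rc ce ij rp fij.
(* By balance [j] alone holds at most [cap p] free pebbles. *)
have fi : 0 < free c p i.
  have := reachable_balanced rc p j.
  by move: fij; rewrite /free_on big_setU1 ?inE //= big_set1; lia.
apply: ReachMove rc _; case: r rp => [/(_ isT) ep|_]; last exact: AddBlack.
by rewrite ep in fij fi *; apply: AddRed.
Qed.

Lemma sparse_constructible (G : bigraph V E) : ab_sparse G a b -> constructible a b G.
Proof.
case=> B' [_ spA spT].
pose col e := if e \in red_edges G :|: B' then Aqua else Tan.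
have spcol p : sparse (ends G) (cap p) (cap p) [set e | col e == p].
  case: p; [have -> : [set e | col e == Aqua] = red_edges G :|: B'
           |have -> : [set e | col e == Tan] = black_edges G :\: B'] => //;
  by apply/setP => e; rewrite /col !inE; case: (is_red G e); case: (e \in B').
have build (s : seq E) : exists2 c, reachable c & forall e,
    uarc c e = if e \in s then Some (ends G e, is_red G e, col e) else None.
  elim: s => [|e s [c rc sh]]; first by exists (initial V E a b) => //; constructor.
  case: (boolP (e \in s)) => es.
    exists c => // x; rewrite sh inE.
    by case: eqP => // ->; rewrite es.
  (* Strict because [e] belongs to the final colour class but is not yet present. *)
  have spanE X : ends G e \subset X ->
      #|pspan c (col e) X| < #|spanned (ends G) [set x | col x == col e] X|.
    move=> eX; apply: proper_card; apply/properP; split; last first.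
      exists e; rewrite !inE ?eqxx //.
      by move: (sh e); rewrite (negPf es) /uarc; case: (arc c e).
    apply/subsetP => x; rewrite !inE /cinc; move: (sh x); rewrite /uarc.
    by case: (arc c x) => //= d; case: ifP => // _ [-> _ ->].
  have spe X : X != set0 -> ends G e \subset X ->
      #|pspan c (col e) X| + cap (col e) < cap (col e) * #|X|.
    move=> X0 /spanE H; have := sparseP _ _ _ _ (spcol (col e)) X X0.
    by apply: leq_trans; rewrite -addSn leq_add2r.
  have /andP[e0 e2] := endsP G e.
  (* A loop is impossible: on its single endpoint [spe] would give [cap < cap]. *)
  have /cards2P[i [j [ij eE]]] : #|ends G e| == 2.
    rewrite eqn_leq e2 ltnNge; apply/negP => e1.
    have := spe (ends G e); rewrite -card_gt0 e0 (eqP (_ : #|ends G e| == 1)) ?eqn_leq ?e1 //.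
    by move=> /(_ isT (subxx _)); lia.
  have [X iX jX|c' [rc' sh' fij]] := collect (p := col e) rc ij.
    apply: spe; first by apply/set0Pn; exists i.
    by rewrite eE; apply/subsetP => v; rewrite !inE => /orP[]/eqP->.
  exists (add_edge c' e i j (is_red G e) (col e)).
    apply: add_reachable => //; last by rewrite /col !inE => ->.
    by have := sh' e; rewrite sh (negPf es) /uarc; case: (arc c' e).
  move=> x; rewrite /uarc /= /set_arc inE; case: eqP => [->|_] /=.
    by rewrite eE.
  by rewrite -sh -sh'.
have [c rc sh] := build (enum E); exists c => // e.
have := sh e; rewrite mem_enum /uarc; case: (arc c e) => //= d [? ? ?].
by exists d.
Qed.

(** The final pebble colours give the partition: red edges are all aqua, so the aqua class contains
    them together with [B'], and the other black edges are tan. *)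
Lemma constructible_sparse (G : bigraph V E) : constructible a b G -> ab_sparse G a b.
Proof.
case=> c rc und; exists (black_edges G :&: covered c Aqua).
have sub p (F : {set E}) : F \subset covered c p ->
    sparse (ends G) (cap p) (cap p) F.
  move=> /subsetP sF; apply/sparseP => X X0.
  apply: leq_trans (sparseP _ _ _ _ (reachable_sparse rc p) X X0).
  rewrite leq_add2r; apply: subset_leq_card; apply/subsetP => e.
  move=> /setIdP[eF eX]; apply/setIdP; split; first exact: sF.
  by rewrite /cinc; have [d [-> -> _]] := und e.
split; first exact: subsetIl.
- apply: (sub Aqua); apply/subsetP => e; rewrite !inE => /orP[re|/andP[] //].
  have [d [ce _ dr]] := und e.
  by rewrite ce (reachable_red rc ce) // dr.
apply: (sub Tan); apply/subsetP => e; rewrite !inE.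
have [d [-> _ _]] := und e.
by case: (cover d); rewrite ?andbT ?andNb.
Qed.

End Game.

Theorem theorem9 (a b : nat) (ha : 0 < a) (hb : 0 < b)
  (V E : finType) (G : bigraph V E) :
  ab_sparse G a b <-> constructible a b G.
Proof. by split; [apply: sparse_constructible | apply: constructible_sparse]. Qed.
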